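(* Let $p$ be a prime, $q=p^m$, $r>1$, and let $L(x)=x^{p^r}-\zeta_{q-1}x\in\mathbb F_q[x]$, where $\zeta_{q-1}$ is a primitive $(q-1)$-th root of unity. If $r$ divides $m$, then $L(x)$ is good exceptional over $\mathbb F_q$.
   Context: A polynomial $f\in\mathbb F_q[x]$ is exceptional over $\mathbb F_q$ if it is a permutation polynomial of $\mathbb F_{q^s}$ (induces a bijection of $\mathbb F_{q^s}$) for infinitely many $s$. An exceptional polynomial $g\in\mathbb F_q[x]$ with $g(0)=0$ and $g'(0)\neq0$ is called good if the roots of $\frac{g(-x)}{-x}$ in $\overline{\mathbb F}_q$ form a unique orbit under the Frobenius map $x\mapsto x^q$. *)

(* Defs.v *)
From HB Require Import structures.
From mathcomp Require Import all_boot all_order all_fingroup all_solvable all_algebra all_field.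
Set Implicit Arguments.
Unset Strict Implicit.
Unset Printing Implicit Defensive.
Import GRing.Theory FinRing.Theory.
Local Open Scope ring_scope.

(* F plays the role of F_q, with q = #|F|.  The field F_{q^s} is modelled by   *)
(* an extension K of F of degree s; it is unique up to F-isomorphism, and      *)
(* finField_ext_exists below shows that the quantification is not vacuous.     *)
Definition permutation_poly_ext (F : finFieldType) (s : nat) (f : {poly F}) :
    Prop :=
  forall K : fieldExtType F, \dim {: K} = s ->
    bijective (fun x : K => (map_poly (in_alg K) f).[x]).

Lemma finField_ext_exists (F : finFieldType) (s : nat) :
  (0 < s)%N -> exists K : fieldExtType F, \dim {: K} = s.
Proof.
move=> s_gt0; pose m := (#|F| ^ s)%N.
have q_gt1 : (1 < #|F|)%N := finNzRing_gt1 F.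
have m_gt1 : (1 < m)%N by rewrite -(expn0 #|F|) ltn_exp2l.
have m_gt0 := ltnW m_gt1.
have m1_gt0 : (0 < m.-1)%N by rewrite -ltnS prednK.
pose Q (R : nzRingType) : {poly R} := 'X^m - 'X.
have DQ (R : nzRingType) : Q R = ('X^(m.-1) - 1) * ('X - 0%:P).
  by rewrite subr0 mulrBl mul1r -exprSr prednK.
have nzQ : Q F != 0 by rewrite DQ monic_neq0 ?rpredM ?monicXsubC ?monicXnsubC.
have [L splitL] := FinSplittingFieldFor nzQ.
rewrite rmorphB rmorphXn /= map_polyX -/(Q L) in splitL.
have [zs DQL defL] := splitL.
have m0 : m%:R = 0 :> L.
  have q0 : #|F|%:R = 0 :> F.
    by rewrite -zmodXgE; apply/eqP; rewrite -order_dvdn -cardsT order_dvdG ?inE.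
  by rewrite natrX -(rmorph_nat (in_alg L)) q0 rmorph0 expr0n gtn_eqF.
have Uzs : uniq zs.
  rewrite -separable_prod_XsubC -(eqp_separable DQL) DQ separable_root andbC.
  rewrite /root !hornerE subr_eq0 eq_sym expr0n gtn_eqF ?oner_eq0 //=.
  rewrite cyclotomic.separable_Xn_sub_1 // -subn1 natrB // subr_eq0.
  by rewrite m0 eq_sym oner_eq0.
have size_zs : size zs = m.
  apply: succn_inj; rewrite -(size_prod_XsubC _ id) -(eqp_size DQL).
  by rewrite size_polyDl ?size_polyXn // size_polyN size_polyX.
have /finField_galois_generator[/= a _ Da] : (1 <= {:L})%VS by apply: sub1v.
pose Em := fixedSpace (a ^+ s)%g; rewrite dimv1 expn1 in Da.
have in_zs : zs =i Em.
  move=> z; rewrite -root_prod_XsubC -(eqp_root DQL) (sameP fixedSpaceP eqP).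
  rewrite /root !hornerE subr_eq0 /= /m; congr (_ == z).
  elim: (s) => [|i IHi]; first by rewrite gal_id.
  by rewrite expgSr expnSr exprM IHi galM ?Da ?memvf.
have defEm : Em = {:L}%VS.
  apply/eqP; rewrite eqEsubv subvf -defL -[Em]subfield_closed agenvS //.
  by rewrite subv_add sub1v; apply/span_subvP=> z; rewrite in_zs.
exists L; apply/eqP; rewrite -(eqn_exp2l _ _ q_gt1) -/m -size_zs.
rewrite -(@card_vspace F (finvect_type L) _ {:L}%VS).
rewrite -(@card_uniqP (finvect_type L) zs Uzs).
by apply/eqP/eq_card=> z; rewrite in_zs defEm.
Qed.

Definition exceptional (F : finFieldType) (f : {poly F}) : Prop :=
  forall N : nat, exists2 s : nat, (N < s)%N & permutation_poly_ext s f.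

(* g(-x)/(-x); the Euclidean quotient is the exact one as soon as g(0) = 0.    *)
Definition neg_quotient (F : fieldType) (g : {poly F}) : {poly F} :=
  (g \Po (- 'X)) %/ (- 'X).

(* The pair (K, iota) ranges over the algebraic closures of F: K is            *)
(* algebraically closed and every element of K is algebraic over iota(F).      *)
(* Such pairs exist by countable_algebraic_closure.  As the orbit is required  *)
(* to have a base point z, the set of roots is nonempty.                       *)
Definition roots_form_frobenius_orbit (F : finFieldType) (h : {poly F}) :
    Prop :=
  forall (K : closedFieldType) (iota : {rmorphism F -> K}),
    integralRange iota ->
    exists z : K, forall x : K,
      root (map_poly iota h) x <->
      exists k : nat, x = iter k (fun y : K => y ^+ #|F|) z.

Definition good_exceptional (F : finFieldType) (g : {poly F}) : Prop :=
  [/\ exceptional g, g.[0] = 0, g^`().[0] != 0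
    & roots_form_frobenius_orbit (neg_quotient g)].

(* Main.v *)
Require Import Defs.
From HB Require Import structures.
From mathcomp Require Import all_boot all_order all_fingroup all_solvable all_algebra all_field.
Set Implicit Arguments.
Unset Strict Implicit.
Unset Printing Implicit Defensive.
Import GRing.Theory.
Local Open Scope ring_scope.

(** If [z ^ (Q - 1) = zeta], where [Q = p ^ r] and [q = #|F|], then
    [z ^ q = omega * z] with [omega = zeta ^ ((q - 1) / (Q - 1))], which is a
    primitive [(Q - 1)]-th root of unity of [F] because [r %| m].  Hence the
    Frobenius orbit of [z] consists of all the [z * omega ^ k], that is, of all
    the roots of ['X^(Q - 1) - zeta].  Moreover [z] can only lie in an extension
    of degree [s] of [F] if [omega ^ s = 1], i.e., if [Q - 1] divides [s]; so the
    additive polynomial ['X^Q - zeta *: 'X] has trivial kernel, and is therefore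
    a permutation, whenever [s] is [1] modulo [Q - 1]. *)

Section KummerFrobenius.

Variables (F : finFieldType) (n : nat) (zeta : F).
Hypotheses (n_dvd : (n %| #|F| - 1)%N) (prim_zeta : (#|F| - 1).-primitive_root zeta).

Let omega : F := zeta ^+ ((#|F| - 1) %/ n).

Lemma kummer_expr_card (R : comNzRingType) (iota : {rmorphism F -> R}) (z : R) :
  z ^+ n = iota zeta -> forall k, z ^+ (#|F| ^ k) = z * iota omega ^+ k.
Proof.
move=> zn; have zq : z ^+ #|F| = z * iota omega.
  (* The exponent is split as [#|F| = 1 + n * ((#|F| - 1) %/ n)]. *)
  rewrite -[in LHS](subnKC (ltnW (finNzRing_gt1 F))) exprS.
  by rewrite -(divnK n_dvd) mulnC exprM zn -rmorphXn.
elim=> [|k IHk]; first by rewrite expr1 mulr1.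
(* The Frobenius fixes [omega], which lies in [F], so each iteration contributes just one more
   factor [omega]. *)
rewrite expnSr exprM IHk exprMn zq -!(rmorphXn iota) expf_card.
by rewrite -mulrA -rmorphM -exprS.
Qed.

Lemma kummer_root_neq0 (K : fieldType) (iota : {rmorphism F -> K}) (z : K) :
  (0 < n)%N -> z ^+ n = iota zeta -> z != 0.
Proof.
move=> n_gt0 zn; have : z ^+ n != 0.
  by rewrite zn fmorph_eq0 (prim_root_eq0 prim_zeta) -lt0n (prim_order_gt0 prim_zeta).
by rewrite expf_eq0 n_gt0.
Qed.

Lemma kummer_frobenius_orbit :
  (0 < n)%N -> roots_form_frobenius_orbit ('X^n - zeta%:P).
Proof.
move=> n_gt0 K iota _.
have rootE x : root (map_poly iota ('X^n - zeta%:P)) x = (x ^+ n == iota zeta).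
  by rewrite rmorphB rmorphXn /= map_polyX map_polyC rootE !hornerE subr_eq0.
have [z] : exists z, root (map_poly iota ('X^n - zeta%:P)) z.
  by apply/closed_rootP; rewrite size_map_poly size_XnsubC // eqSS -lt0n.
rewrite rootE => /eqP zn; exists z => x.
have z_nz : z != 0 := kummer_root_neq0 n_gt0 zn.
have iterE k : iter k (fun y : K => y ^+ #|F|) z = z * iota omega ^+ k.
  rewrite -(kummer_expr_card zn); elim: k => [|k IHk]; first by rewrite expr1.
  by rewrite iterS IHk expnSr exprM.
have prim_omega : n.-primitive_root (iota omega).
  by rewrite fmorph_primitive_root dvdn_prim_root.
rewrite rootE; split=> [/eqP xn | [k ->]].
  (* Two roots differ by an [n]-th root of unity, hence by a power of [omega]. *)
  have /(prim_rootP prim_omega)[k xzE] : (x / z) ^+ n = 1.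
    by rewrite expr_div_n xn zn divff // fmorph_eq0 -(fmorph_eq0 iota) -zn expf_neq0.
  by exists k; rewrite iterE -xzE mulrC divfK.
by rewrite iterE exprMn zn exprAC (prim_expr_order prim_omega) expr1n mulr1.
Qed.

(** With [s] the degree of [K], the [s]-th Frobenius iterate fixes [z] but also multiplies it by
    [omega ^+ s]; cancelling [z] leaves [omega ^+ s = 1]. *)
Lemma kummer_root_dim (K : fieldExtType F) (z : K) :
  (0 < n)%N -> z ^+ n = in_alg K zeta -> (n %| \dim {: K})%N.
Proof.
move=> n_gt0 zn; rewrite (prim_order_dvd (dvdn_prim_root prim_zeta n_dvd)).
rewrite -/omega -(fmorph_eq1 (in_alg K)) rmorphXn.
apply/eqP/(mulfI (kummer_root_neq0 n_gt0 zn)).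
rewrite -(kummer_expr_card zn) mulr1.
rewrite -(@card_vspace F (finvect_type K)) card_vspacef.
exact: (@expf_card (finvect_type K)).
Qed.

End KummerFrobenius.

Lemma bij_linearized_binomial (F : finFieldType) (K : fieldExtType F) (Q : nat) (a : F) :
    [pchar F].-nat Q -> (forall z : K, z ^+ (Q - 1) != in_alg K a) ->
  bijective (fun x : K => (map_poly (in_alg K) ('X^Q - a *: 'X)).[x]).
Proof.
move=> pQ noroot; apply: (@injF_bij (finvect_type K)) => x y /=.
have Q_gt0 : (0 < Q)%N by case/andP: pQ.
have pK : [pchar K].-nat Q by rewrite (eq_pnat _ (fmorph_pchar (in_alg K))).
have fE (u : K) : (map_poly (in_alg K) ('X^Q - a *: 'X)).[u] = u ^+ Q - in_alg K a * u.
  by rewrite rmorphB /= map_polyXn map_polyZ map_polyX !hornerE.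
(* By additivity [d = x - y] lies in the kernel; if nonzero, dividing [d ^+ Q = a * d] by [d] gives
   a forbidden root. *)
rewrite !fE => fxy; apply/eqP; rewrite -subr_eq0; apply: contraNT (noroot (x - y)) => d_nz.
apply/eqP/(mulIf d_nz); rewrite -exprSr subn1 prednK //.
rewrite exprDn_pchar // exprNn_pchar // mulrBr.
by rewrite -[x ^+ Q](subrK (in_alg K a * x)) fxy addrC !addrA addNr add0r addrC.
Qed.

Lemma neg_quotient_linearized_binomial (F : finFieldType) (Q : nat) (a : F) :
  [pchar F].-nat Q -> neg_quotient ('X^Q - a *: 'X) = 'X^(Q - 1) - a%:P.
Proof.
move=> pQ; have Q_gt0 : (0 < Q)%N by case/andP: pQ.
(* This makes [(- 'X) ^+ Q = - 'X^Q] hold even for [Q] even, where the characteristic is 2. *)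
have pPQ : [pchar {poly F}].-nat Q by rewrite (eq_pnat _ (pchar_lalg _)).
rewrite /neg_quotient comp_polyB comp_polyZ comp_polyX comp_Xn_poly exprNn_pchar //.
have -> : - 'X^Q - a *: (- 'X) = ('X^(Q - 1) - a%:P) * (- 'X) :> {poly F}.
  by rewrite mulrN mulrBl -exprSr subn1 prednK // mul_polyC scalerN opprD.
by rewrite mulpK // oppr_eq0 polyX_eq0.
Qed.

Theorem proposition6p2 (p m r : nat) (F : finFieldType) (zeta : F) :
  prime p -> #|F| = (p ^ m)%N -> (1 < r)%N ->
  (#|F| - 1).-primitive_root zeta ->
  (r %| m)%N ->
  good_exceptional ('X^(p ^ r) - zeta *: 'X).
Proof.
move=> p_pr cardF r_gt1 prim_zeta r_dvd; set Q := (p ^ r)%N.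
have pQ : [pchar F].-nat Q.
  by rewrite pnatX pnatE // (card_finPcharP cardF p_pr).
(* Here [1 < r] excludes [Q = 2], for which [Q - 1 = 1] would divide every degree. *)
have Q_gt2 : (2 < Q)%N.
  have r_lt : (2 ^ 1 < 2 ^ r)%N by rewrite ltn_exp2l.
  by rewrite (leq_trans r_lt) // leq_exp2r ?prime_gt1 // ltnW.
have n_gt1 : (1 < Q - 1)%N by rewrite ltn_subRL.
have n_gt0 := ltnW n_gt1.
have n_dvd : (Q - 1 %| #|F| - 1)%N.
  (* [#|F|] is the power [Q ^ (m %/ r)]. *)
  by rewrite cardF -(divnK r_dvd) mulnC expnM !subn1 dvdn_pred_predX.
split.
(* This degree exceeds [N] and is 1 modulo [Q - 1], so [Q - 1 > 1] cannot divide it. *)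
- move=> N; exists ((Q - 1) * N.+1 + 1)%N => [|K dimK].
    by rewrite addn1 ltnS (leq_trans (leqnSn N)) ?leq_pmull.
  apply: bij_linearized_binomial => // z; apply/eqP.
  move=> /(kummer_root_dim n_dvd prim_zeta n_gt0).
  by rewrite dimK dvdn_addr ?dvdn_mulr // dvdn1 gtn_eqF.
- by rewrite !hornerE expr0n gtn_eqF ?subr0 // (ltn_trans _ Q_gt2).
- rewrite derivB derivZ derivXn derivX !hornerE hornerMn hornerXn expr0n -subn1.
  rewrite gtn_eqF // mul0rn sub0r oppr_eq0 (prim_root_eq0 prim_zeta).
  by rewrite -lt0n (prim_order_gt0 prim_zeta).
rewrite neg_quotient_linearized_binomial //.
exact: kummer_frobenius_orbit.
Qed.
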